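(* Let $T$ be a tree with $n$ vertices and $m=n-1$ edges, with degree sequence $\mathscr{D}=(d_1,d_2,\dots,d_n)$ where $d_1\geqslant d_2\geqslant\dots\geqslant d_n$, and let $\lambda_{\mathscr{D}}=\frac1n\sum_{i=1}^n d_i$ be the average of $\mathscr{D}$. Then \[ \sigma(T)\leqslant \sum_{i=1}^{n}d_i^3+\frac{2\lambda_{\mathscr{D}}(n^2+m^2)}{3(n+m)}. \]
   Context: For a graph $G$, $d_G(v)$ denotes the degree of vertex $v$. The Sigma index of $G$ is $\sigma(G)=\sum_{uv\in E(G)}(d_G(u)-d_G(v))^2$. *)

(* Defs.v *)
From mathcomp Require Import all_boot all_order all_algebra.

Set Implicit Arguments.
Unset Strict Implicit.
Unset Printing Implicit Defensive.

Import Order.TTheory GRing.Theory Num.Theory.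

Local Open Scope ring_scope.

Record sgraph := SGraph {
  vertex :> finType;
  adj : rel vertex;
  adj_sym : symmetric adj;
  adj_irrefl : irreflexive adj
}.

Definition deg (G : sgraph) (v : G) : nat := #|[set w : G | adj v w]|.

(* The edge uv is represented by whichever of (u, v), (v, u) is increasing
   for the enumeration of the vertices, so each edge is listed exactly once. *)
Definition edges (G : sgraph) : {set G * G} :=
  [set p : G * G | adj p.1 p.2 && (enum_rank p.1 < enum_rank p.2)%N].

Definition connected (G : sgraph) : Prop := forall x y : G, connect (@adj G) x y.

(* An edge traversed back and forth is a ucycle of size 2, hence the bound. *)
Definition acyclic (G : sgraph) : Prop :=
  forall c : seq G, ucycle (@adj G) c -> (size c < 3)%N.

Definition is_tree (G : sgraph) : Prop :=
  [/\ (0 < #|G|)%N, connected G & acyclic G].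

Definition sigma_index (G : sgraph) : int :=
  \sum_(p in edges G) ((deg p.1)%:Z - (deg p.2)%:Z) ^+ 2.

Definition degree_sequence (G : sgraph) (n : nat) (d : n.-tuple nat) : Prop :=
  perm_eq d [seq deg v | v <- enum G] /\ sorted geq d.

Definition average (n : nat) (d : n.-tuple nat) : rat :=
  (\sum_(i < n) (tnth d i)%:R) / n%:R.

(* Main.v *)
Require Import Defs.
From mathcomp Require Import all_boot all_order all_algebra.

Import Order.TTheory GRing.Theory Num.Theory.

Local Open Scope ring_scope.

(** Summing [(d(u) - d(v))^2 <= d(u)^2 + d(v)^2] over the edges bounds [sigma(T)]
    by [\sum_v d(v)^3], by double counting; the remaining term of the bound is
    nonnegative. *)

(** The cubes arise because [v] lies on [deg v] edges, so its square is counted [deg v] times: this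
    is [sum_edges_endpoints] at the squared degree. [sigma_index_le_sum_cube] drops the cross terms,
    and [sum_degree_sequence] passes from indices to vertices. *)

Lemma sum_edges_endpoints (V : nmodType) (G : sgraph) (f : G -> V) :
  \sum_(p in edges G) (f p.1 + f p.2) = \sum_(v : G) f v *+ deg v.
Proof.
(* Pass to ordered adjacent pairs: [v] comes first in [deg v] of them. *)
have -> : \sum_(v : G) f v *+ deg v = \sum_(p : G * G | adj p.1 p.2) f p.1.
  rewrite -(pair_big_dep predT (@adj G) (fun u _ => f u)) /=.
  by apply: eq_bigr => v _; rewrite sumr_const /deg cardsE.
rewrite [RHS](bigID (fun p : G * G => (enum_rank p.1 < enum_rank p.2)%N)) /=.
rewrite big_split /=; congr (_ + _).
  by apply: eq_bigl => p; rewrite inE.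
(* The pairs not increasing in rank are the edges reversed, so swapping turns their first endpoints
   into second endpoints of edges. *)
rewrite [RHS](reindex_inj (can_inj (@swap_pairK G G))) /=.
apply: eq_bigl => -[u v]; rewrite inE /= adj_sym.
have [uv|] := boolP (adj v u); rewrite //= -leqNgt [RHS]leq_eqVlt.
(* Equal ranks would make the pair a loop. *)
case: eqP => // /ord_inj/enum_rank_inj uv_eq.
by rewrite uv_eq adj_irrefl in uv.
Qed.

Lemma sigma_index_le_sum_cube (G : sgraph) :
  sigma_index G <= \sum_(v : G) (deg v)%:Z ^+ 3.
Proof.
have -> : \sum_(v : G) (deg v)%:Z ^+ 3 = \sum_(v : G) (deg v)%:Z ^+ 2 *+ deg v.
  by apply: eq_bigr => v _; rewrite exprSr -mulr_natr natz.
rewrite -sum_edges_endpoints; apply: ler_sum => p _.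
(* After expansion only the sign of the cross term [- 2 d(u) d(v)] matters. *)
by rewrite sqrrB -addrA addrCA gerDr oppr_le0 mulrn_wge0 ?mulr_ge0.
Qed.

Lemma sum_degree_sequence (V : nmodType) (G : sgraph) (n : nat)
    (d : n.-tuple nat) (F : nat -> V) :
  degree_sequence G d -> \sum_(i < n) F (tnth d i) = \sum_(v : G) F (deg v).
Proof.
case=> d_deg _; rewrite -(big_tuple _ _ _ predT).
by rewrite (perm_big _ d_deg) /= big_map big_enum.
Qed.

Theorem theorem3p6 (T : sgraph) (n m : nat) (d : n.-tuple nat)
    (hT : is_tree T)
    (hn : #|T| = n)
    (hm : #|edges T| = m)
    (hmn : m = (n - 1)%N)
    (hd : degree_sequence T d) :
  ((sigma_index T)%:~R : rat) <=
    \sum_(i < n) ((tnth d i)%:R : rat) ^+ 3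
    + (2 * average d * (n%:R ^+ 2 + m%:R ^+ 2)) / (3 * (n%:R + m%:R)).
Proof.
have average_ge0 : 0 <= average d.
  by rewrite divr_ge0 // sumr_ge0 // => i _; rewrite ler0n.
rewrite -[leLHS]addr0 lerD //; last first.
  by rewrite !(average_ge0, divr_ge0, mulr_ge0, addr_ge0, exprn_ge0, ler0n).
rewrite (sum_degree_sequence _ _ _ _ (fun k => (k%:R : rat) ^+ 3) hd).
(* Pull the cast out of the sum, to compare in [int]. *)
have -> : \sum_(v : T) ((deg v)%:R : rat) ^+ 3
        = (\sum_(v : T) (deg v)%:Z ^+ 3)%:~R.
  by rewrite rmorph_sum; apply: eq_bigr => v _; rewrite rmorphXn.
by rewrite ler_int sigma_index_le_sum_cube.
Qed.
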